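(* For all integers $r\ge 0$, $z\ge 1$ and all $k\ge 2$, $N(r,z,k)<N(r,z,k+1)$.
   Context: A (finite) mixed graph $G$ consists of a vertex set $V(G)$, a set of undirected edges and a set of directed arcs (ordered pairs of vertices). Loops are forbidden, as are parallel edges and arcs. Write $u\sim v$ if there is an edge between $u$ and $v$, and $u\to v$ if there is an arc from $u$ to $v$. The undirected degree of $u$ is the number of edges incident with $u$; the directed out-degree of $u$ is the number of arcs with initial vertex $u$. A walk of length $\ell$ from $u_0$ to $u_\ell$ is a sequence $u_0u_1\dots u_\ell$ of vertices such that for each $0\le i\le \ell-1$ either $u_i\sim u_{i+1}$ or $u_i\to u_{i+1}$. A mixed path is a non-backtracking walk, i.e. a walk that never traverses an edge and then immediately retraces it (no $u_i\sim u_{i+1}\sim u_i$); walks of length $0$ are allowed. $G$ is $k$-geodetic if for every ordered pair $(u,v)$ of (not necessarily distinct) vertices there is at most one mixed path from $u$ to $v$ of length $\le k$. $N(r,z,k)$ denotes the smallest possible order of a $k$-geodetic mixed graph with minimum undirected degree $r$ and minimum directed out-degree $z$ (such graphs exist for all $r\ge 0$, $z,k\ge 1$). The case $r=0$ is that of purely directed graphs. *)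

(* Defs.v *)
From mathcomp Require Import all_boot.
From mathcomp Require Import boolp classical_sets.

Set Implicit Arguments.
Unset Strict Implicit.
Unset Printing Implicit Defensive.

(* [edge_arc] forbids an edge and an arc between the same two vertices in
   either orientation, as [edge] is symmetric.  Opposite arcs are allowed. *)
Record mixed_graph := MixedGraph {
  vertex :> finType;
  edge : rel vertex;
  arc : rel vertex;
  edge_sym : symmetric edge;
  edge_irr : irreflexive edge;
  arc_irr : irreflexive arc;
  edge_arc : forall u v : vertex, edge u v -> ~~ arc u v }.

Definition undirected_degree (G : mixed_graph) (u : G) : nat :=
  #|[set v : G | edge u v]%SET|.

Definition out_degree (G : mixed_graph) (u : G) : nat :=
  #|[set v : G | arc u v]%SET|.

Definition step (G : mixed_graph) : rel G :=
  [rel u v : G | edge u v || arc u v].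

Fixpoint nonbacktracking (G : mixed_graph) (w : seq G) : bool :=
  if w is x :: w' then
    (if w' is y :: t :: _ then ~~ [&& edge x y, edge y t & t == x] else true)
    && nonbacktracking w'
  else true.

(* The sequence u :: p is a mixed path from u to v, of length [size p]. *)
Definition mixed_path (G : mixed_graph) (u v : G) (p : seq G) : bool :=
  [&& path (@step G) u p, last u p == v & nonbacktracking (u :: p)].

Definition geodetic (k : nat) (G : mixed_graph) : Prop :=
  forall (u v : G) (p q : seq G),
    mixed_path u v p -> size p <= k ->
    mixed_path u v q -> size q <= k -> p = q.

Definition is_minimum (T : Type) (f : T -> nat) (m : nat) : Prop :=
  (exists x, f x = m) /\ (forall x, m <= f x).

Definition geodetic_order (r z k n : nat) : Prop :=
  exists G : mixed_graph,
    [/\ is_minimum (@undirected_degree G) r,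
        is_minimum (@out_degree G) z,
        geodetic k G
      & #|G| = n].

(* The number N(r,z,k); it has the junk value 0 if no such graph exists. *)
Definition min_order (r z k : nat) : nat :=
  xget 0 [set n | geodetic_order r z k n /\
                  forall m, geodetic_order r z k m -> n <= m]%classic.

(* Main.v *)
From mathcomp Require Import boolp classical_sets.
From mathcomp Require Import all_boot fingroup perm.
Require Import Defs.

(** Two things have to be shown: that the orders compared exist at all, and that
    a (k+1)-geodetic graph G with minimum degrees at least r and z can be turned
    into a smaller k-geodetic graph with the same bounds on its degrees.  Lower
    bounds on the degrees suffice, because superfluous edges and arcs can be
    deleted without changing the order until both minima are exactly r and z
    ([geodetic_order_of_min_degrees]).

    Shrinking a graph.  Project V(G) onto a smaller set, and let only some
    vertices of each fibre be exits, i.e. vertices through which the fibre may be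
    left.  A path of the quotient lifts to a path of G which, inside a fibre, may
    have to jump from the vertex where it came in to the exit where it goes on;
    each jump costs one step.  If the vertices from which one may have to jump
    are pairwise adjacent, a lift of a path of length at most k jumps at most
    once: two jumps would give, in G, a closed walk of length at most k+1 or a
    second short path between adjacent vertices ([size_lift]).  So lifts have
    length at most k+1, and the quotient is k-geodetic ([quotient_geodetic]).

    This is used in two ways.  If some edge ux has d(u) + d(x) >= r + 2, contract
    it; the new vertex has undirected degree d(u) + d(x) - 2 ([contraction]).
    Otherwise every vertex on an edge has undirected degree 1, so that a vertex u
    together with its possible neighbour is a union of components of the
    undirected part of G.  Delete u and this neighbour, and redirect each arc
    that pointed to a deleted vertex d to an out-neighbour of d ([deletion]);
    this affects no undirected degree.

    Existence.  Let every letter, one for each of r edges and z arcs, act on the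
    words of length at most k by a permutation that prepends the letter whenever
    there is room, where the permutation of an edge letter is an involution that
    also erases the letter.  In the Cayley graph of the symmetric group for
    these permutations, a mixed path of length at most k is spelled by a word
    which can be read off from its two ends, namely by its action on the empty
    word ([word_graph_geodetic]). *)

Set Implicit Arguments.
Unset Strict Implicit.
Unset Printing Implicit Defensive.

(** * Short paths in geodetic graphs *)

Lemma edge_step (G : mixed_graph) (u v : G) : edge u v -> step u v.
Proof. by rewrite /step /= => ->. Qed.

Lemma arc_step (G : mixed_graph) (u v : G) : arc u v -> step u v.
Proof. by rewrite /step /= orbC => ->. Qed.

Section ShortPaths.

Variables (G : mixed_graph) (k : nat).
Hypothesis geoG : geodetic k G.

Lemma geodetic_acyclic (u x : G) p :
  mixed_path u u (x :: p) -> size p < k -> False.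
Proof.
move=> up lt_pk; suff: x :: p = [::] by [].
by apply: (geoG up) => //; rewrite /mixed_path /= eqxx.
Qed.

Lemma geodetic_no_triangle (u v w : G) :
  2 <= k -> step u v -> step v w -> step u w -> w != u -> False.
Proof.
move=> k2 uv vw uw wu; suff: [:: v; w] = [:: w] by [].
apply: (geoG (u := u) (v := w)); rewrite /mixed_path /= ?uv ?vw ?uw ?eqxx //.
  by rewrite (negPf wu) !andbF.
exact: ltnW.
Qed.

Lemma geodetic_no_diamond (u v v' w : G) :
    2 <= k -> step u v -> step v w -> step u v' -> step v' w -> w != u ->
  v = v'.
Proof.
move=> k2 uv vw uv' v'w wu; suff: [:: v; w] = [:: v'; w] by case.
apply: (geoG (u := u) (v := w));
  by rewrite /mixed_path /= ?uv ?vw ?uv' ?v'w ?eqxx // (negPf wu) !andbF.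
Qed.

End ShortPaths.

Lemma nonbacktracking_prefix (G : mixed_graph) (s t : seq G) :
  nonbacktracking (s ++ t) -> nonbacktracking s.
Proof.
elim: s => //= x [|y [|z s]] IH //=.
by move=> /andP[-> nbs]; exact: IH.
Qed.

(** * Quotients of geodetic graphs *)

Section Quotient.

Variables (G : mixed_graph) (W : finType) (pi : G -> W) (sg : W -> G).
(** [E] is the set of exits; [sg] picks an exit in each fibre of [pi]. *)
Variables (E : pred G) (k : nat).

Hypothesis sgK : cancel sg pi.
Hypothesis sgE : forall w, E (sg w).

(** A walk that enters its fibre at [d] may have to jump to another vertex before
    it can leave. *)
Definition jumper d := exists2 e, E e & e != d /\ pi e = pi d.

Hypothesis jump_step :
  forall d e, E e -> pi d = pi e -> d != e -> step d e.
Hypothesis jumper_clique :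
  forall d d', jumper d -> jumper d' -> d != d' -> step d d'.
Hypothesis k_gt0 : 0 < k.
Hypothesis geoG : geodetic k.+1 G.

(** A vertex of a fibre that is not its chosen exit is a jumper: it has a step to
    the chosen exit, and any two such vertices are adjacent. *)
Lemma fibre_step b b' : pi b = pi b' -> b != b' -> step b b' \/ step b' b.
Proof.
have jP c : c != sg (pi c) -> jumper c.
  by move=> nc; exists (sg (pi c)); rewrite // sgK eq_sym.
move=> bb' nbb'.
have [eb|/jP jb] := eqVneq b (sg (pi b)).
  by right; apply: jump_step; rewrite ?bb' 1?eq_sym // eb sgE.
have [eb'|/jP jb'] := eqVneq b' (sg (pi b')).
  by left; apply: jump_step; rewrite ?bb' // eb' sgE.
by left; apply: jumper_clique.
Qed.

(** Two lifts of the same pair that differ at an end are joined, inside the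
    fibres, by steps of G; these close a triangle or a diamond, and a
    2-geodetic graph has neither.  This is why distinct neighbours stay distinct
    in the quotient and why no edge is parallel to an arc there. *)
Lemma unique_lift e e' b b' :
    E e -> E e' -> pi e = pi e' -> pi b = pi b' -> pi e != pi b ->
  step e b -> step e' b' -> e = e' /\ b = b'.
Proof.
wlog bb : e e' b b' / b = b' \/ step b b'.
  move=> IH Ee Ee' ee' bb' neb eb e'b'.
  have [eqb|nbb'] := eqVneq b b'; first by apply: IH => //; left.
  have [sb|sb] := fibre_step bb' nbb'; first by apply: IH => //; right.
  by have [] : e' = e /\ b' = b by apply: IH; rewrite -?ee' -?bb' //; right.
move=> Ee Ee' ee' bb' neb eb e'b'.
have nb'e : b' != e by apply: contraNneq neb => <-; rewrite bb'.
have k2 : 2 <= k.+1 by [].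
have [eqe|nee'] := eqVneq e e'.
  rewrite -eqe in e'b'; case: bb => // sb.
  by case: (geodetic_no_triangle geoG k2 eb sb e'b' nb'e).
have see' : step e e' by apply: jump_step.
case: bb => [eqb|sb].
  rewrite eqb in eb.
  by case: (geodetic_no_triangle geoG k2 see' e'b' eb nb'e).
have eqb := geodetic_no_diamond geoG k2 eb sb see' e'b' nb'e.
by rewrite eqb ee' eqxx in neb.
Qed.

(** An edge can be traversed both ways, so both its ends have to be exits; an
    arc may enter a fibre anywhere.  In a deletion the deleted vertices are not
    exits, so that their arcs are redirected but their edges disappear. *)
Definition quotient_edge : rel W := fun a b => (a != b) &&
  [exists eb : G * G,
    [&& pi eb.1 == a, pi eb.2 == b, E eb.1, E eb.2 & edge eb.1 eb.2]].

Definition quotient_arc : rel W := fun a b => (a != b) &&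
  [exists eb : G * G, [&& pi eb.1 == a, pi eb.2 == b, E eb.1 & arc eb.1 eb.2]].

Lemma quotient_edgeP a b :
  reflect (a != b /\ exists e e', [/\ pi e = a, pi e' = b, E e, E e' & edge e e'])
          (quotient_edge a b).
Proof.
apply: (iffP andP) => [] [nab].
  by case/existsP=> -[e e'] /and5P[/eqP ? /eqP ? ? ? ?]; split=> //; exists e, e'.
case=> e [e' [ea eb Ee Ee' ee']]; split=> //; apply/existsP; exists (e, e').
by rewrite /= ea eb !eqxx Ee Ee'.
Qed.

Lemma quotient_arcP a b :
  reflect (a != b /\ exists e e', [/\ pi e = a, pi e' = b, E e & arc e e'])
          (quotient_arc a b).
Proof.
apply: (iffP andP) => [] [nab].
  by case/existsP=> -[e e'] /and4P[/eqP ? /eqP ? ? ?]; split=> //; exists e, e'.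
case=> e [e' [ea eb Ee ee']]; split=> //; apply/existsP; exists (e, e').
by rewrite /= ea eb !eqxx Ee.
Qed.

Lemma quotient_edge_sym : symmetric quotient_edge.
Proof.
move=> a b; apply/quotient_edgeP/quotient_edgeP=> -[nab [e [e' [? ? ? ? ?]]]];
  by split; [rewrite eq_sym | exists e', e; rewrite edge_sym].
Qed.

Lemma quotient_edge_irr : irreflexive quotient_edge.
Proof. by move=> a; rewrite /quotient_edge eqxx. Qed.

Lemma quotient_arc_irr : irreflexive quotient_arc.
Proof. by move=> a; rewrite /quotient_arc eqxx. Qed.

Lemma quotient_edge_arc a b : quotient_edge a b -> ~~ quotient_arc a b.
Proof.
case/quotient_edgeP=> nab [e [e' [ea eb Ee Ee' ee']]].
apply/quotient_arcP=> -[_ [f [f' [fa fb Ff ff']]]].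
have [|||||eqe eqe'] := @unique_lift e f e' f' Ee Ff; rewrite ?ea ?eb ?fa ?fb //=.
- exact: edge_step.
- exact: arc_step.
by move: (edge_arc ee'); rewrite eqe eqe' ff'.
Qed.

Definition quotient : mixed_graph :=
  MixedGraph quotient_edge_sym quotient_edge_irr quotient_arc_irr
             quotient_edge_arc.

(** * Lifting paths from a quotient *)

Definition lift_rel a b (eb : G * G) : bool :=
  [&& pi eb.1 == a, pi eb.2 == b, E eb.1
    & E eb.2 && edge eb.1 eb.2 || arc eb.1 eb.2].

Definition lift_step a b : G * G :=
  odflt (sg a, sg b) [pick eb | lift_rel a b eb].

Lemma lift_stepP (a b : quotient) (eb := lift_step a b) : step a b ->
  [/\ a != b, pi eb.1 = a, pi eb.2 = b, E eb.1
    & E eb.2 && edge eb.1 eb.2 || arc eb.1 eb.2].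
Proof.
move=> sab; have [nab [eb0 Leb]] : a != b /\ exists eb, lift_rel a b eb.
  case/orP: sab => [/quotient_edgeP|/quotient_arcP] [nab [e [e']]].
    case=> ea e'b Ee Ee' ee'; split=> //; exists (e, e').
    by rewrite /lift_rel /= ea e'b !eqxx Ee Ee' ee'.
  case=> ea e'b Ee ee'; split=> //; exists (e, e').
  by rewrite /lift_rel /= ea e'b !eqxx Ee ee' orbT.
rewrite {}/eb /lift_step; case: pickP => [eb /and4P[/eqP ? /eqP ? ? ?] // |].
by move/(_ eb0); rewrite Leb.
Qed.

Definition jump (g e : G) : seq G := if g == e then [::] else [:: e].

(** The lift starts at [g], the vertex of the current fibre that the walk has
    reached.  The jump at the very end leads to the chosen exit of the last
    fibre, so that paths with the same ends have lifts with the same ends. *)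
Fixpoint lift (g : G) (p : seq W) : seq G :=
  if p is b :: p' then
    let: (e, e') := lift_step (pi g) b in jump g e ++ e' :: lift e' p'
  else jump g (sg (pi g)).

Lemma last_jump x g e : last x (g :: jump g e) = e.
Proof. by rewrite /jump; case: eqP => [->|]. Qed.

Lemma path_jump g e : E e -> pi g = pi e -> path (@step G) g (jump g e).
Proof.
move=> Ee ge; rewrite /jump; case: ifPn => //= ne.
by rewrite jump_step.
Qed.

Lemma lift_path (g : G) (p : seq W) :
  path (@step quotient) (pi g) p -> path (@step G) g (lift g p).
Proof.
elim: p g => [|b p IH] g /=; first by rewrite path_jump // sgK.
case/andP=> /lift_stepP; case: lift_step => e e' [/= nab ea eb Ee ee'].
rewrite -{1}eb => /IH pp; rewrite cat_path path_jump ?ea //.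
rewrite -[last _ _]/(last g (g :: _)) last_jump /= pp andbT.
by case/orP: ee' => [/andP[_ /edge_step]|/arc_step].
Qed.

Lemma last_lift (g : G) (p : seq W) :
  path (@step quotient) (pi g) p -> last g (lift g p) = sg (last (pi g) p).
Proof.
elim: p g => [|b p IH] g /=.
  by rewrite -[LHS]/(last g (g :: _)) last_jump.
case/andP=> /lift_stepP; case: lift_step => e e' [/= _ _ eb _ _].
by rewrite -{1}eb => /IH; rewrite last_cat /= eb.
Qed.

(** A jump stays in a fibre and every other step of the lift changes the fibre,
    so a jump is not retraced.  If two consecutive steps without a jump retrace
    an edge of G, then both ends of that edge are exits, so it projects to an
    edge that the given path retraces. *)
Lemma lift_nonbacktracking (g : G) (p : seq W) :
    path (@step quotient) (pi g) p -> @nonbacktracking quotient (pi g :: p) ->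
  nonbacktracking (g :: lift g p).
Proof.
elim: p g => [|b p IH] g /=; first by rewrite /jump; case: ifP.
case/andP=> /lift_stepP; case: lift_step => e e' [/= nab ea eb Ee ee'].
subst b => pp /andP[nb1 nbp].
have nbe : nonbacktracking (e :: e' :: lift e' p).
  have := IH _ pp nbp; rewrite /= => ->; rewrite andbT.
  case: p pp nb1 {nbp IH} => [|c p] /= pp nb1.
    rewrite /jump; case: ifP => //= _.
    by apply/and3P=> -[_ _ /eqP et]; rewrite -ea -et sgK eqxx in nab.
  case/andP: pp => /lift_stepP; case: lift_step => f f' [/= nbc fb fc Ef ff'] _.
  rewrite /jump; case: (eqVneq e' f) => [eqf|_] /=.
    apply/and3P=> -[eee' e'f' /eqP et]; subst f f'; case/and3P: nb1.
    rewrite -fc ea; split=> //.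
      by apply/quotient_edgeP; split=> //; exists e, e'.
    apply/quotient_edgeP; split; first by rewrite eq_sym.
    by exists e', e; rewrite edge_sym.
  by apply/and3P=> -[_ _ /eqP et]; rewrite -ea -et fb eqxx in nab.
move: nbe; rewrite /jump; case: eqP => [->|_] //= ->; rewrite andbT.
by apply/and3P=> -[_ _ /eqP et]; rewrite et eqxx in nab.
Qed.

(** Projects a walk of G to the quotient, where [a] is the projection of the
    preceding vertex, and forgets the jumps: this is a left inverse of [lift]. *)
Fixpoint project a (s : seq G) : seq W :=
  if s is x :: s' then
    if pi x == a then project a s' else pi x :: project (pi x) s'
  else [::].

Lemma liftK (g : G) (p : seq W) :
  path (@step quotient) (pi g) p -> project (pi g) (lift g p) = p.
Proof.
elim: p g => [|b p IH] g /=.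
  by rewrite /jump; case: ifP => //=; rewrite sgK eqxx.
case/andP=> /lift_stepP; case: lift_step => e e' [/= nab ea eb Ee ee'].
rewrite -{1}eb => /IH eqp; suff eqs : project (pi g) (e' :: lift e' p) = b :: p.
  by rewrite /jump; case: ifP => //= _; rewrite ea eqxx.
by rewrite /= {1}eb [b == _]eq_sym (negPf nab) eqp eb.
Qed.

(** The part [s] of the lift before its first jump contains one vertex per step
    of the path, whence the bound on its size. *)
Lemma lift_first_jump (g : G) (p : seq W) :
    path (@step quotient) (pi g) p ->
  size (lift g p) = size p \/
  exists s t, [/\ lift g p = s ++ t, jumper (last g s) & size s <= size p].
Proof.
elim: p g => [|b p IH] g /=.
  move=> _; rewrite /jump; case: ifPn => [|ng]; [by left | right].
  exists [::], [:: sg (pi g)]; split=> //=.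
  by exists (sg (pi g)); rewrite // eq_sym sgK.
case/andP=> /lift_stepP; case: lift_step => e e' [/= nab ea eb Ee ee'].
rewrite -{1}eb => /IH IHp; rewrite /jump; case: ifPn => ng /=; last first.
  right; exists [::], (e :: e' :: lift e' p); split=> //=.
  by exists e; rewrite // eq_sym.
case: IHp => [->|[s [t [-> js les]]]]; first by left.
by right; exists (e' :: s), t.
Qed.

(** If the lift jumps at [g] and then again, the part between is a path of length
    between 2 and k+1 joining two vertices that are equal or adjacent by
    [jumper_clique]; the trivial path or the adjacency is then a second path. *)
Lemma size_lift (g : G) (p : seq W) :
    path (@step quotient) (pi g) p -> @nonbacktracking quotient (pi g :: p) ->
  size p <= k -> size (lift g p) <= (size p).+1.
Proof.
elim: p g => [|b p IH] g; first by rewrite /= /jump; case: ifP.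
move=> pbp nbp le_pk.
have := lift_path pbp; have := lift_nonbacktracking pbp nbp.
move: pbp nbp => /=.
case/andP=> /lift_stepP; case: lift_step => e e' [/= nab ea eb Ee ee'].
subst b => pp /andP[_ nbp].
have {IH} := IH _ pp nbp (ltnW le_pk).
rewrite /jump; case: ifPn => // ng le_lift.
case: (lift_first_jump pp) => [/= -> //|[s [t [-> js les]]]] /=.
move=> /(@nonbacktracking_prefix _ [:: g, e, e' & s]) nbs.
rewrite cat_path => /and4P[ge ee1 ps _].
have jg : jumper g by exists e; rewrite // eq_sym.
have gs : mixed_path g (last e' s) [:: e, e' & s].
  by rewrite /mixed_path /= ge ee1 ps eqxx.
have [eqg|ngs] := eqVneq g (last e' s).
  (* Both jumps start at [g]: a closed path. *)
  rewrite -eqg in gs; case: (geodetic_acyclic geoG gs).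
  by rewrite ltnS (leq_ltn_trans les).
suff: [:: e, e' & s] = [:: last e' s] by [].
apply: (geoG gs) => //; first by rewrite ltnS (leq_ltn_trans les).
by rewrite /mixed_path /= eqxx jumper_clique.
Qed.

Theorem quotient_geodetic : geodetic k quotient.
Proof.
have lifted (a b : quotient) p : mixed_path a b p -> size p <= k ->
    mixed_path (sg a) (sg b) (lift (sg a) p) /\ size (lift (sg a) p) <= k.+1.
  rewrite /mixed_path -{1 2 3}[a]sgK => /and3P[pp /eqP <- nbp] le_pk.
  rewrite lift_path // last_lift // eqxx lift_nonbacktracking //.
  by split=> //; apply: leq_trans (size_lift pp nbp le_pk) _.
move=> a b p q ap le_pk aq le_qk.
have [ap' le_pk'] := lifted _ _ _ ap le_pk.
have [aq' le_qk'] := lifted _ _ _ aq le_qk.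
have pathE c : mixed_path a b c -> path (@step quotient) (pi (sg a)) c.
  by rewrite sgK => /and3P[].
rewrite -(liftK (pathE p ap)) -(liftK (pathE q aq)).
by rewrite (geoG ap' le_pk' aq' le_qk').
Qed.

(** [A] may collect neighbours of several vertices of the fibre: for a contracted
    edge it joins the neighbourhoods of both ends. *)
Lemma quotient_undirected_degree (w : quotient) (A : {set G}) :
    (forall a, a \in A ->
      [/\ E a, pi a != w & exists2 e, E e & pi e = w /\ edge e a]) ->
  #|A| <= undirected_degree w.
Proof.
move=> hA; rewrite -(card_in_imset (f := pi) (D := A)); last first.
  move=> a b /hA[_ naw [e Ee [ew ea]]] /hA[_ _ [f Ef [fw fb]]] ab.
  by case: (@unique_lift e f a b); rewrite ?edge_step ?ew ?fw // eq_sym.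
apply/subset_leq_card/subsetP=> _ /imsetP[a /hA[Ea naw [e Ee [ew ea]]] ->].
rewrite inE; apply/quotient_edgeP; split; first by rewrite eq_sym.
by exists e, a.
Qed.

(** An arc that leaves the exit [sg w] also leaves its fibre, since otherwise a
    jump would lead back and close a walk of length 2. *)
Lemma quotient_out_degree (w : quotient) :
  out_degree (sg w) <= out_degree w.
Proof.
have far b : arc (sg w) b -> pi (sg w) != pi b.
  move=> wb; apply/eqP=> eqb.
  have nbw : b != sg w by apply: contraTneq wb => ->; rewrite arc_irr.
  have sb := jump_step (sgE w) (esym eqb) nbw.
  apply: (geodetic_acyclic geoG (u := sg w) (x := b) (p := [:: sg w])) => //.
  rewrite /mixed_path /= sb (arc_step wb) eqxx /= !andbT.
  by case: (boolP (edge (sg w) b)) => // /edge_arc; rewrite wb.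
rewrite /out_degree -(card_in_imset (f := pi) (D := [set v | arc (sg w) v])).
  apply/subset_leq_card/subsetP=> y /imsetP[b]; rewrite inE => wb ->{y}.
  rewrite inE; apply/quotient_arcP; have := far _ wb; rewrite sgK => nwb.
  by split=> //; exists (sg w), b.
move=> a b; rewrite !inE => wa wb ab.
by case: (@unique_lift (sg w) (sg w) a b); rewrite ?far ?arc_step.
Qed.

End Quotient.

(** * Trimming a graph to exact minimum degrees *)

Definition min_degrees (r z : nat) (G : mixed_graph) : Prop :=
  forall u : G, r <= undirected_degree u /\ z <= out_degree u.

Section Subgraph.

Variables (G : mixed_graph) (e a : rel G).
Hypotheses (e_sym : symmetric e) (sub_e : subrel e (@edge G)).
Hypothesis sub_a : subrel a (@arc G).

Lemma subgraph_edge_irr : irreflexive e.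
Proof. by move=> u; apply/idP=> /sub_e; rewrite edge_irr. Qed.

Lemma subgraph_arc_irr : irreflexive a.
Proof. by move=> u; apply/idP=> /sub_a; rewrite arc_irr. Qed.

Lemma subgraph_edge_arc u v : e u v -> ~~ a u v.
Proof. by move=> /sub_e /edge_arc; apply: contra; exact: sub_a. Qed.

Definition subgraph : mixed_graph :=
  MixedGraph e_sym subgraph_edge_irr subgraph_arc_irr subgraph_edge_arc.

Lemma subgraph_step : subrel (@step subgraph) (@step G).
Proof.
by move=> u v /orP[/sub_e/edge_step | /sub_a/arc_step].
Qed.

Lemma subgraph_edge (u v : G) : @step subgraph u v -> edge u v -> e u v.
Proof. by case/orP=> // /sub_a uv /edge_arc; rewrite uv. Qed.

(** The condition on backtracking refers to edges only; it is the same in the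
    subgraph because G has no arc parallel to an edge. *)
Lemma subgraph_mixed_path (u v : subgraph) p :
  mixed_path u v p -> @mixed_path G u v p.
Proof.
case/and3P=> up lp nb; apply/and3P; split=> //.
  exact: sub_path subgraph_step _ _ up.
elim: p u up nb {lp} => [|x [|y p] IH] u //= /and3P[ux xy yp] /andP[nb nbp].
have /= -> : @nonbacktracking G (x :: y :: p) by apply: IH; rewrite //= ?xy.
rewrite andbT; apply: contra nb => /and3P[eux exy ->].
by rewrite (subgraph_edge ux eux) (subgraph_edge xy exy).
Qed.

Lemma subgraph_geodetic k : geodetic k G -> geodetic k subgraph.
Proof.
move=> geo u v p q up le_pk uq le_qk.
exact: geo (subgraph_mixed_path up) le_pk (subgraph_mixed_path uq) le_qk.
Qed.

End Subgraph.

Lemma subset_of_card (T : finType) (A : {set T}) n :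
  n <= #|A| -> exists2 B : {set T}, B \subset A & #|B| = n.
Proof.
move=> le_nA; exists [set x in take n (enum A)].
  by apply/subsetP=> x; rewrite inE => /mem_take; rewrite mem_enum.
rewrite cardsE (card_uniqP _) ?take_uniq ?enum_uniq //.
by rewrite size_take_min -cardE; apply/minn_idPl.
Qed.

(** Trim the edges and the arcs at a vertex [u0] of least undirected degree.  The
    other vertices lose at most one edge each, and they can afford it: if [u0]
    loses an edge at all, then every undirected degree exceeds r. *)
Lemma geodetic_order_of_min_degrees r z k (G : mixed_graph) (u : G) :
  min_degrees r z G -> geodetic k G -> geodetic_order r z k #|G|.
Proof.
move=> deg geo.
pose u0 := [arg min_(v < u) undirected_degree v].
have u0_min (v : G) : undirected_degree u0 <= undirected_degree v.
  by rewrite /u0; case: arg_minnP => // i _; exact.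
have [R subR cardR] := subset_of_card (deg u0).1.
have [Z subZ cardZ] := subset_of_card (deg u0).2.
pose e v w := [&& edge v w, (v == u0) ==> (w \in R) & (w == u0) ==> (v \in R)].
pose a v w := arc v w && ((v == u0) ==> (w \in Z)).
have e_sym : symmetric e by move=> v w; rewrite /e edge_sym andbCA andbC andbA.
have sub_e : subrel e (@edge G) by move=> v w /and3P[].
have sub_a : subrel a (@arc G) by move=> v w /andP[].
pose H := subgraph e_sym sub_e sub_a.
have u0R : u0 \notin R.
  by apply/negP=> /(subsetP subR); rewrite inE edge_irr.
have deg_u0 : @undirected_degree H u0 = r.
  rewrite -cardR; apply: eq_card => v; rewrite !inE /= /e eqxx /=.
  case: (boolP (v \in R)) => vR; last by rewrite andbF.
  have := subsetP subR _ vR; rewrite inE => uv; rewrite uv /=.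
  by apply/implyP=> /eqP eqv; rewrite eqv (negPf u0R) in vR.
have out_u0 : @out_degree H u0 = z.
  rewrite -cardZ; apply: eq_card => v; rewrite !inE /= /a eqxx /=.
  case: (boolP (v \in Z)) => vZ; last by rewrite andbF.
  by have := subsetP subZ _ vZ; rewrite inE => ->.
exists H; split=> //; last exact: subgraph_geodetic.
  split=> [|v]; first by exists u0.
  have [-> | nv] := eqVneq v u0; first by rewrite deg_u0.
  have [dr | ndr] := eqVneq (undirected_degree u0) r.
    have RE : R = [set w | edge u0 w].
      by apply/eqP; rewrite eqEcard subR cardR -dr leqnn.
    apply: (leq_trans (deg v).1); apply/subset_leq_card/subsetP=> w.
    rewrite !inE /= /e (negPf nv) => vw; rewrite vw /=; apply/implyP=> /eqP wu.
    by rewrite RE inE edge_sym -wu.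
  have lt_r : r < @undirected_degree G v.
    by apply: leq_trans (u0_min v); rewrite ltn_neqAle eq_sym ndr (deg u0).1.
  rewrite -ltnS; apply: (leq_trans lt_r).
  have subv : [set w | @edge G v w] \subset u0 |: [set w : G | e v w].
    apply/subsetP=> w; rewrite !inE /e => ->; rewrite (negPf nv) /=.
    by case: eqVneq.
  apply: (leq_trans (subset_leq_card subv)); rewrite cardsU1.
  by rewrite -[X in _ <= X]add1n leq_add2r leq_b1.
split=> [|v]; first by exists u0.
have [-> | nv] := eqVneq v u0; first by rewrite out_u0.
apply: (leq_trans (deg v).2); apply/subset_leq_card/subsetP=> w.
by rewrite !inE /= /a (negPf nv) => ->.
Qed.

(** * Shrinking a geodetic graph *)

Definition has_smaller_geodetic (r z k : nat) (G : mixed_graph) : Prop :=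
  exists (H : mixed_graph) (_ : H),
    [/\ min_degrees r z H, geodetic k H & #|H| < #|G|].

(** The quotients that are used come from idempotent maps [f] of the vertex set:
    the vertices of the quotient are the fixed points of [f]. *)
Section Retract.

Variables (G : mixed_graph) (f : G -> G) (E : pred G) (r z k : nat).

Hypothesis f_idem : forall v, f (f v) = f v.
Hypothesis f_E : forall v, E (f v).
Hypothesis jump_step :
  forall d e, E e -> f d = f e -> d != e -> step d e.
Hypothesis jumper_clique :
  forall d d', jumper f E d -> jumper f E d' -> d != d' -> step d d'.
Hypothesis k_gt0 : 0 < k.
Hypothesis geoG : geodetic k.+1 G.
Hypothesis degG : forall w, f w = w -> exists A : {set G}, r <= #|A| /\
  forall a, a \in A ->
    [/\ E a, f a != w & exists2 e, E e & f e = w /\ edge e a].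
Hypothesis outG : forall w : G, z <= out_degree w.

Lemma retract_smaller u : f u != u -> has_smaller_geodetic r z k G.
Proof.
move=> fu.
have fixf v : f (f v) == f v by rewrite f_idem.
pose W : finType := {w : G | f w == w}.
pose pi (v : G) : W := exist _ (f v) (fixf v).
pose sg (w : W) : G := val w.
have sgf (w : W) : f (sg w) = sg w by apply/eqP; exact: (valP w).
have sgK : cancel sg pi by move=> w; apply: val_inj; exact: sgf.
have piE v w : pi v = pi w -> f v = f w by case.
have sgE w : E (sg w) by rewrite -sgf.
have pi_jump d e : E e -> pi d = pi e -> d != e -> step d e.
  by move=> Ee /piE; exact: jump_step.
have jP d : jumper pi E d -> jumper f E d.
  by case=> e Ee [ed /piE fed]; exists e.
have pi_clique d d' : jumper pi E d -> jumper pi E d' -> d != d' -> step d d'.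
  by move=> /jP jd /jP jd'; exact: jumper_clique.
pose H := quotient sgK sgE pi_jump pi_clique k_gt0 geoG.
exists H, (pi u); split; last 1 first.
- rewrite /= card_sig -[X in _ < X]cardsT -cardsE.
  apply/proper_card/properP; split; first by apply/subsetP=> w _; rewrite inE.
  by exists u; rewrite !inE.
- move=> w; split; last exact: leq_trans (outG _) (quotient_out_degree _).
  have [A [leA hA]] := degG (sgf w); apply: (leq_trans leA).
  apply: quotient_undirected_degree => a /hA[Ea na [e Ee [ew ea]]].
  split=> //; exists e => //; split=> //; apply: val_inj; exact: ew.
- exact: quotient_geodetic.
Qed.

End Retract.

(** The quotient that maps [u] to [x], all vertices being exits: a walk jumps
    when it passes the contracted edge. *)
Lemma contraction (G : mixed_graph) (u x : G) r z k :
    0 < k -> geodetic k.+1 G -> min_degrees r z G -> edge u x ->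
    r.+2 <= undirected_degree u + undirected_degree x ->
  has_smaller_geodetic r z k G.
Proof.
move=> k_gt0 geo deg ux le_r.
have nux : u != x by apply: contraTneq ux => ->; rewrite edge_irr.
pose f v := if v == u then x else v.
have fP v w : f v = f w -> v != w -> (v = u /\ w = x) \/ (v = x /\ w = u).
  rewrite /f; case: (eqVneq v u) => [->|_]; case: (eqVneq w u) => [->|_] fvw.
  - by [].
  - by left.
  - by right.
  - by rewrite fvw eqxx.
have jP d : jumper f predT d -> d = u \/ d = x.
  by case=> e _ [ned /fP]; case=> // -[]; auto.
apply: (@retract_smaller G f predT r z k _ _ _ _ _ _ _ _ u) => //.
- move=> v; rewrite /f.
  by case: (eqVneq v u) => [_|/negPf nvu]; [case: ifP | rewrite nvu].
- by move=> d e _ /fP fde /fde[] [-> ->]; apply: edge_step; rewrite // edge_sym.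
- move=> d d' /jP[] -> /jP[] ->; rewrite ?eqxx // => _; apply: edge_step => //.
  by rewrite edge_sym.
- move=> w fw; have nwu : w != u.
    by apply: contra_eqN fw => /eqP->; rewrite /f eqxx eq_sym.
  have [eqw|nwx] := eqVneq w x; last first.
    exists [set v | edge w v]; split=> [|v]; first exact: (deg w).1.
    rewrite inE => wv; split=> //; last by exists w.
    rewrite /f; case: (eqVneq v u) => _; first by rewrite eq_sym.
    by apply: contraTneq wv => ->; rewrite edge_irr.
  subst w; pose A := [set v | edge x v] :\ u; pose B := [set v | edge u v] :\ x.
  (* [A] and [B] are disjoint since G has no triangle. *)
  exists (A :|: B); split=> [|v].
    have AB0 : A :&: B = set0.
      apply/setP=> v; rewrite !inE.
      apply/negbTE/negP=> /andP[/andP[nvu xv] /andP[nvx uv]].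
      by apply: (geodetic_no_triangle geo (u := u) (v := x) (w := v));
         rewrite ?edge_step.
    have := cardsD1 u [set v | edge x v]; have := cardsD1 x [set v | edge u v].
    rewrite !inE ux edge_sym ux -/A -/B cardsU AB0 cards0 subn0.
    move: le_r; rewrite /undirected_degree => le_r eu ex.
    move: le_r; rewrite eu ex addnACA addnC -[1 + 1]/2 addn2 !ltnS.
    by rewrite [#|A| + _]addnC.
  rewrite !inE => /orP[] /andP[nv ev]; split=> //.
  + by rewrite /f (negPf nv); apply: contraTneq ev => ->; rewrite edge_irr.
  + by exists x => //; split=> //; rewrite /f eq_sym (negPf nux).
  + by rewrite /f; case: (eqVneq v u) => [vu|//]; rewrite vu edge_irr in ev.
  + by exists u => //; split=> //; rewrite /f eqxx.
- by move=> w; exact: (deg w).2.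
- by rewrite /f eqxx eq_sym.
Qed.

(** The quotient that maps each [v] in [S] to an out-neighbour of [v], the
    vertices outside [S] being the exits: a walk jumps when it uses a redirected
    arc.  Only vertices of [S] can jump, so [S] has to be a clique, and the other
    vertices keep their edges because [S] is closed under adjacency. *)
Lemma deletion (G : mixed_graph) (S : {set G}) (u : G) r z k :
    0 < k -> 0 < z -> geodetic k.+1 G -> min_degrees r z G -> u \in S ->
    {in S &, forall v w, v != w -> edge v w} ->
    (forall v w, v \in S -> edge v w -> w \in S) ->
  has_smaller_geodetic r z k G.
Proof.
move=> k_gt0 z_gt0 geo deg uS clique closed.
pose next (v : G) := odflt v [pick w | arc v w].
have nextP v : arc v (next v).
  rewrite /next; case: pickP => //= no; have := (deg v).2.
  rewrite /out_degree; have -> : [set w | arc v w] = set0.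
    by apply/setP=> w; rewrite !inE no.
  by rewrite cards0 leqNgt z_gt0.
have nextS v : v \in S -> next v \notin S.
  move=> vS; apply/negP=> nS; have := nextP v.
  have [<-|nv] := eqVneq v (next v); first by rewrite arc_irr.
  by rewrite (negPf (edge_arc (clique _ _ vS nS nv))).
pose f v := if v \in S then next v else v.
pose E : pred G := [pred v | v \notin S].
have f_E v : E (f v) by rewrite /E /f /=; case: ifPn => // /nextS.
have fE v : E v -> f v = v by rewrite /E /f /= => /negPf->.
have jP d e : E e -> f d = f e -> d != e -> d \in S.
  move=> Ee fde; apply: contraNT => dS.
  by rewrite -(fE _ Ee) -fde fE.
have jS d : jumper f E d -> d \in S.
  by case=> e Ee [ned fed]; apply: (jP d e) => //; rewrite eq_sym.
apply: (@retract_smaller G f E r z k _ f_E _ _ _ _ _ _ u) => //.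
- by move=> v; rewrite fE.
- move=> d e Ee fde nde; have dS := jP _ _ Ee fde nde.
  by apply: arc_step; rewrite -(fE _ Ee) -fde /f dS.
- by move=> d d' /jS dS /jS d'S ndd; apply: edge_step; exact: clique.
- move=> w fw; have Ew : E w by rewrite -fw.
  exists [set v | edge w v]; split=> [|v]; first exact: (deg w).1.
  rewrite inE => wv; have Ev : E v.
    by apply: contra Ew => vS; apply: closed vS _; rewrite edge_sym.
  split=> //; last by exists w.
  by rewrite fE //; apply: contraTneq wv => ->; rewrite edge_irr.
- by move=> w; exact: (deg w).2.
- by apply: contraTneq (f_E u) => ->; rewrite /E /= uS.
Qed.

(** When no edge can be contracted, d(u) + d(x) <= r + 1 for every edge ux, while
    both degrees are at least r and at least 1; so both are 1, and the edges form
    a matching. *)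
Lemma smaller_graph (G : mixed_graph) (u : G) r z k :
    0 < k -> 0 < z -> geodetic k.+1 G -> min_degrees r z G ->
  has_smaller_geodetic r z k G.
Proof.
move=> k_gt0 z_gt0 geo deg.
case: (pickP [pred vw : G * G | edge vw.1 vw.2 &&
          (r.+2 <= undirected_degree vw.1 + undirected_degree vw.2)]).
  by move=> [v w] /= /andP[vw le_r]; exact: contraction vw le_r.
move=> sparse.
have deg1 (v w : G) : edge v w -> undirected_degree v = 1.
  move=> vw; have dv : 0 < undirected_degree v.
    by apply/card_gt0P; exists w; rewrite inE.
  have dw : 0 < undirected_degree w.
    by apply/card_gt0P; exists v; rewrite inE edge_sym.
  have := sparse (v, w); rewrite /= vw /= => /negbT; rewrite -ltnNge ltnS => le_r.
  apply/eqP; rewrite eqn_leq dv andbT.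
  rewrite -(leq_add2r (undirected_degree w)) (leq_trans le_r) //.
  by rewrite add1n ltnS (deg w).1.
have matching (v w w' : G) : edge v w -> edge v w' -> w = w'.
  move=> vw vw'; have /eqP/cards1P[y Ny] := deg1 _ _ vw.
  have : w \in [set y] by rewrite -Ny inE.
  have : w' \in [set y] by rewrite -Ny inE.
  by rewrite !inE => /eqP-> /eqP->.
apply: (@deletion G [set v | (v == u) || edge u v] u) => //.
- by rewrite inE eqxx.
- move=> v w; rewrite !inE => /orP[/eqP->|uv] /orP[/eqP->|uw]; rewrite ?eqxx //.
    by rewrite edge_sym.
  by rewrite (matching _ _ _ uv uw) eqxx.
- move=> v w; rewrite !inE => /orP[/eqP->|uv] vw; first by rewrite vw orbT.
  by rewrite (matching v w u) ?eqxx // edge_sym.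
Qed.

(** * Permutations of bounded words *)

Section Words.

Variables (A : eqType) (k : nat).
Implicit Types (a : A) (w : seq A).

Definition starts a w := if w is b :: _ then b == a else false.

(** On a word with at most one leading [a], this erases or prepends [a]; a word
    that starts with two letters [a], or that has no [a] to erase and no room to
    prepend one, is fixed.  These exceptions make it an involution on all words
    of length at most k. *)
Definition toggle a w :=
  if starts a w then (if starts a (behead w) then w else behead w)
  else if size w < k then a :: w else w.

Lemma toggleK a w : size w <= k -> toggle a (toggle a w) = w.
Proof.
move=> le_wk; rewrite {2}/toggle; case: ifPn => [|naw].
  case: w le_wk => //= b w le_wk /eqP-> {b}; case: ifPn => aw.
    by rewrite /toggle /= eqxx aw.
  by rewrite /toggle (negPf aw) le_wk.
case: ifPn => lt_wk; first by rewrite /toggle /= eqxx (negPf naw).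
by rewrite /toggle (negPf naw) (negPf lt_wk).
Qed.

Lemma size_toggle a w : size w <= k -> size (toggle a w) <= k.
Proof.
move=> le_wk; rewrite /toggle; case: ifP => _; case: ifP => // _.
by rewrite size_behead (leq_trans (leq_pred _)).
Qed.

Fixpoint strip a w :=
  if w is b :: w' then if b == a then strip a w' else w else [::].

Lemma starts_strip a w : starts a (strip a w) = false.
Proof. by elim: w => //= b w IH; case: ifP. Qed.

Lemma size_strip a w : size (strip a w) <= size w.
Proof. by elim: w => //= b w IH; case: ifP => //= _; exact: leqW. Qed.

Lemma strip_cat a w : nseq (size w - size (strip a w)) a ++ strip a w = w.
Proof.
elim: w => //= b w IH; case: ifP => [/eqP-> | _] /=; last by rewrite subnn.
by rewrite subSn ?size_strip //= IH.
Qed.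

(** This prepends [a] when there is room; a full word loses its leading run of
    [a], which makes the map a bijection: it is a union of cycles
    v, av, aav, ..., one for each word v that does not start with [a]. *)
Definition push a w := if size w < k then a :: w else strip a w.

(** A full word is recovered from its stripped form, because its leading run
    fills the length up to k. *)
Lemma push_inj a w w' :
  size w <= k -> size w' <= k -> push a w = push a w' -> w = w'.
Proof.
have full (v : seq A) : size v <= k -> ~~ (size v < k) -> size v = k.
  by move=> le_v; rewrite -leqNgt => ge_v; apply/eqP; rewrite eqn_leq le_v.
move=> le_w le_w'; rewrite /push; case: ifPn => lt_w; case: ifPn => lt_w' eqw.
- by case: eqw.
- by move: (starts_strip a w'); rewrite -eqw /= eqxx.
- by move: (starts_strip a w); rewrite eqw /= eqxx.
by rewrite -(strip_cat a w) -(strip_cat a w') eqw (full w) // (full w').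
Qed.

Lemma size_push a w : size w <= k -> size (push a w) <= k.
Proof.
move=> le_w; rewrite /push; case: ifP => // _.
exact: leq_trans (size_strip _ _) le_w.
Qed.

End Words.

(** * A Cayley graph without short coincidences *)

Section Existence.

Variables (r z k : nat).

Let letter : finType := ('I_r + 'I_z)%type.
Let word : finType := k.-bseq letter.

Definition write (c : letter) (w : seq letter) : seq letter :=
  if c is inl _ then toggle k c w else push k c w.

Lemma size_write c w : size w <= k -> size (write c w) <= k.
Proof. by case: c => i; [exact: size_toggle | exact: size_push]. Qed.

Definition write_word c (w : word) : word := Bseq (size_write c (size_bseq w)).

Lemma write_word_inj c : injective (write_word c).
Proof.
move=> w w' /(congr1 val) /=; case: c => i eqw; apply: val_inj => /=.
  rewrite -(toggleK (inl i) (size_bseq w)) [toggle _ _ w]eqw.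
  by rewrite toggleK ?size_bseq.
by apply: push_inj eqw; exact: size_bseq.
Qed.

Definition write_perm c : {perm word} := perm (@write_word_inj c).

Definition translate (g : {perm word}) c : {perm word} := (g * write_perm c)%g.

Lemma translateE (g : {perm word}) c x : val (translate g c x) = write c (g x).
Proof. by rewrite permM permE. Qed.

Lemma translateK i (g : {perm word}) :
  translate (translate g (inl i)) (inl i) = g.
Proof.
by apply/permP=> x; apply: val_inj; rewrite !translateE /= toggleK ?size_bseq.
Qed.

(** The word that [g] sends to the empty word; following it along a walk from [g]
    spells the walk, with the last letter in front. *)
Definition origin (g : {perm word}) : word := (g^-1)%g [bseq].

Lemma originE (g : {perm word}) : g (origin g) = [bseq].
Proof. exact: permKV. Qed.

(** [translate g c] sends [origin g] to the one-letter word [c], which determines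
    [c]. *)
Lemma translate_inj (g : {perm word}) : 0 < k -> injective (translate g).
Proof.
move=> k_gt0; have val_translate c : val (translate g c (origin g)) = [:: c].
  by rewrite translateE originE; case: c => i; rewrite /= /toggle /push /= k_gt0.
by move=> c d eq_cd; move: (val_translate c); rewrite eq_cd val_translate => -[].
Qed.

Hypothesis k_gt0 : 0 < k.

Definition word_edge (g h : {perm word}) := [exists i, h == translate g (inl i)].
Definition word_arc (g h : {perm word}) := [exists j, h == translate g (inr j)].

Lemma word_edge_sym : symmetric word_edge.
Proof.
have sub g h : word_edge g h -> word_edge h g.
  by case/existsP=> i /eqP->; apply/existsP; exists i; rewrite translateK.
by move=> g h; apply/idP/idP; exact: sub.
Qed.

Lemma translate_neq (g : {perm word}) c : translate g c != g.
Proof.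
apply/eqP=> /permP/(_ (origin g))/(congr1 val).
rewrite translateE originE.
by case: c => i; rewrite /= /toggle /push /= k_gt0.
Qed.

Lemma word_edge_irr : irreflexive word_edge.
Proof.
by move=> g; apply/existsP=> -[i]; rewrite eq_sym (negPf (translate_neq _ _)).
Qed.

Lemma word_arc_irr : irreflexive word_arc.
Proof.
by move=> g; apply/existsP=> -[i]; rewrite eq_sym (negPf (translate_neq _ _)).
Qed.

Lemma word_edge_arc g h : word_edge g h -> ~~ word_arc g h.
Proof.
case/existsP=> i /eqP->; apply/existsP=> -[j /eqP].
by move/(translate_inj k_gt0).
Qed.

Definition word_graph : mixed_graph :=
  MixedGraph word_edge_sym word_edge_irr word_arc_irr word_edge_arc.

Lemma word_graph_step (g h : word_graph) :
  step g h -> exists c, h = translate g c.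
Proof. by case/orP=> /existsP[i /eqP->]; eexists. Qed.

(** The word at [x] grows by one letter at each step.  It could shrink only at an
    edge letter equal to the letter just written, and that step would retrace an
    edge; the last hypothesis excludes it at the start. *)
Lemma word_graph_walk (g : word_graph) (p : seq word_graph) (x : word) :
    path (@step word_graph) g p -> @nonbacktracking word_graph (g :: p) ->
    size (g x) + size p <= k ->
    (forall i, starts (inl i) (g x) -> ohead p != Some (translate g (inl i))) ->
  exists2 w, p = scanl translate g w & val (last g p x) = catrev w (g x).
Proof.
elim: p g => [|h p IH] g /=; first by exists [::].
case/andP=> /word_graph_step[c ->] {h} pp /andP[nb1 nbp] le_k red.
have cx : val (translate g c x) = c :: g x.
  have lt_k : size (g x) < k.
    by apply: leq_trans le_k; rewrite addnS ltnS leq_addr.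
  rewrite translateE; case: c red {pp nb1 nbp} => i red /=.
    by rewrite /toggle lt_k; case: ifP => // /red; rewrite eqxx.
  by rewrite /push lt_k.
have [|i|w -> lastw] := IH _ pp nbp.
- by rewrite cx /= addSnnS.
- rewrite cx => /= /eqP eqc; case: p pp nb1 {IH nbp le_k} => //= h p _ nb1.
  apply: contra nb1 => /eqP[->]; rewrite eqc translateK eqxx andbT.
  have e1 : word_edge g (translate g (inl i)) by apply/existsP; exists i.
  by rewrite e1 word_edge_sym e1.
by exists (c :: w); rewrite //= lastw cx.
Qed.

Lemma word_graph_geodetic : geodetic k word_graph.
Proof.
have spell (g h : word_graph) p : mixed_path g h p -> size p <= k ->
    exists2 w, p = scanl translate g w & val (h (origin g)) = rev w.
  case/and3P=> pp /eqP <- nbp le_pk.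
  have [||w pw ->] := word_graph_walk (x := origin g) pp nbp.
  - by rewrite originE.
  - by rewrite originE.
  by exists w; rewrite // originE.
move=> g h p q gp le_pk gq le_qk.
have [w -> hw] := spell _ _ _ gp le_pk; have [w' -> hw'] := spell _ _ _ gq le_qk.
by rewrite -[w]revK -hw hw' revK.
Qed.

Lemma word_graph_min_degrees : min_degrees r z word_graph.
Proof.
move=> g; split.
  rewrite -[r in r <= _]card_ord.
  rewrite -(card_imset predT (f := fun i => translate g (inl i))).
    apply/subset_leq_card/subsetP=> _ /imsetP[i _ ->].
    by rewrite inE; apply/existsP; exists i.
  by move=> i j /(translate_inj k_gt0)[].
rewrite -[z in z <= _]card_ord.
rewrite -(card_imset predT (f := fun i => translate g (inr i))).
  apply/subset_leq_card/subsetP=> _ /imsetP[i _ ->].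
  by rewrite inE; apply/existsP; exists i.
by move=> i j /(translate_inj k_gt0)[].
Qed.

End Existence.

Lemma geodetic_order_exists r z k :
  0 < k -> exists n, geodetic_order r z k n.
Proof.
move=> k_gt0; exists #|word_graph r z k_gt0|.
apply: (geodetic_order_of_min_degrees (1%g : word_graph r z k_gt0)).
  exact: word_graph_min_degrees.
exact: word_graph_geodetic.
Qed.

(** * Comparison of the least orders *)

Lemma min_orderP r z k n : geodetic_order r z k n ->
  geodetic_order r z k (min_order r z k) /\ min_order r z k <= n.
Proof.
move=> Gn.
have [m [/asboolP Gm min_m]] : exists m, `[< geodetic_order r z k m >] /\
    forall i, geodetic_order r z k i -> m <= i.
  have exG : exists m, `[< geodetic_order r z k m >] by exists n; apply/asboolP.
  case: (ex_minnP exG) => m Gm min_m; exists m; split=> // i Gi.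
  by apply: min_m; apply/asboolP.
have := @xgetPex _ 0 [set m | geodetic_order r z k m /\
  forall i, geodetic_order r z k i -> m <= i]%classic.
case; first by exists m.
by move=> Gmin min_le; split; last exact: min_le.
Qed.

Theorem theorem9 (r z k : nat) (hz : 1 <= z) (hk : 2 <= k) :
  min_order r z k < min_order r z k.+1.
Proof.
have [n] := geodetic_order_exists r z (ltn0Sn k).
case/min_orderP=> -[G [degG outG geoG <-]] _.
have degGe : min_degrees r z G.
  by move=> w; split; [exact: degG.2 | exact: outG.2].
have [[u _] _] := degG.
have [H [v [degH geoH lt_HG]]] := smaller_graph u (ltnW hk) hz geoG degGe.
apply: leq_ltn_trans lt_HG.
exact: (min_orderP (geodetic_order_of_min_degrees v degH geoH)).2.
Qed.
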